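(* Let $d > 1$ be an integer and $p$ a prime. Consider the game in which Nora and Wanda choose the coefficients of a degree $d$ polynomial from $\mathbb{Q}$, and Wanda wins if and only if the final polynomial has a root in $D_2$, where $D_2$ is any (unital) subring of $\mathbb{Q}_p$, the field of $p$-adic numbers. Then the player who makes the last move has a winning strategy.
   Context: The game: Nora and Wanda alternately choose coefficients of a polynomial $f(x) = a_d x^d + \cdots + a_1 x + a_0$; on each move the current player picks a not-yet-chosen coefficient $a_i$ and assigns it a value in $\mathbb{Q}$, subject to $a_d \neq 0$ and $a_0 \neq 0$. After all $d+1$ coefficients are chosen, Wanda wins if $f$ has a root in $D_2$, and Nora wins otherwise. Who moves first is fixed in advance, which determines who makes the last move; ''the player who makes the last move has a winning strategy'' is asserted for either such assignment. *)

(* Defs.v *)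
From HB Require Import structures.
From mathcomp Require Import all_boot all_order all_algebra.
Set Implicit Arguments. Unset Strict Implicit. Unset Printing Implicit Defensive.
Import Order.TTheory GRing.Theory Num.Theory.
Local Open Scope ring_scope.

(* raw representative of a p-adic number: (k, x) denotes x / p^k, x in Z_p *)
Definition Qp_raw := (nat * (nat -> int))%type.

Definition ppow (p n : nat) : int := (p%:Z) ^+ n.

Definition Zp_coherent (p : nat) (x : nat -> int) : Prop :=
  forall n : nat, (ppow p n %| (x n.+1 - x n))%Z.

Definition Qp_valid (p : nat) (x : Qp_raw) : Prop := Zp_coherent p x.2.

(* equality in Q_p:  x1/p^k = y1/p^l  iff  p^l x1 = p^k y1 in Z_p *)
Definition Qp_eq (p : nat) (x y : Qp_raw) : Prop :=
  forall n : nat, (ppow p n %| (ppow p y.1 * x.2 n - ppow p x.1 * y.2 n))%Z.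

Definition Qp_zero : Qp_raw := (0%N, fun _ => 0).
Definition Qp_one : Qp_raw := (0%N, fun _ => 1).
Definition Qp_add (p : nat) (x y : Qp_raw) : Qp_raw :=
  ((x.1 + y.1)%N, fun n => ppow p y.1 * x.2 n + ppow p x.1 * y.2 n).
Definition Qp_opp (x : Qp_raw) : Qp_raw := (x.1, fun n => - x.2 n).
Definition Qp_mul (x y : Qp_raw) : Qp_raw :=
  ((x.1 + y.1)%N, fun n => x.2 n * y.2 n).
Definition Qp_pow (x : Qp_raw) (i : nat) : Qp_raw := iter i (Qp_mul x) Qp_one.

(* canonical embedding Q -> Q_p: q = a / (p^v * c) with c coprime to p;
   c^{-1} mod p^n is c^(phi(p^n) - 1) *)
Definition Qp_of_rat (p : nat) (q : rat) : Qp_raw :=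
  let b := `|denq q|%N in
  let v := logn p b in
  let c := (b %/ p ^ v)%N in
  (v, fun n => numq q * ((c ^ (totient (p ^ n)).-1)%N)%:Z).

(* D is a unital subring of Q_p (given as a predicate on representatives,
   saturated for Qp_eq) *)
Definition Qp_subring (p : nat) (D : Qp_raw -> Prop) : Prop :=
  (forall x, D x -> Qp_valid p x) /\
  (forall x y, Qp_valid p y -> Qp_eq p x y -> D x -> D y) /\
  D Qp_one /\
  (forall x y, D x -> D y -> D (Qp_add p x y)) /\
  (forall x, D x -> D (Qp_opp x)) /\
  (forall x y, D x -> D y -> D (Qp_mul x y)).

Inductive player := Nora | Wanda.
Definition other (P : player) : player :=
  match P with Nora => Wanda | Wanda => Nora end.

Definition state (d : nat) := {ffun 'I_d.+1 -> option rat}.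

Definition empty_state (d : nat) : state d := [ffun _ => None].

Definition assign (d : nat) (s : state d) (i : 'I_d.+1) (c : rat) : state d :=
  [ffun j => if j == i then Some c else s j].

Definition legal (d : nat) (s : state d) (i : 'I_d.+1) (c : rat) : Prop :=
  s i = None /\ (((val i == 0)%N || (val i == d)) -> c != 0).

Definition eval_state (p d : nat) (s : state d) (x : Qp_raw) : Qp_raw :=
  foldr (fun i acc => Qp_add p (Qp_mul (Qp_of_rat p (odflt 0 (s i))) (Qp_pow x i)) acc)
        Qp_zero (enum 'I_d.+1).

Definition has_root_in (p d : nat) (D : Qp_raw -> Prop) (s : state d) : Prop :=
  exists x, D x /\ Qp_eq p (eval_state p s x) Qp_zero.

Definition wins (p d : nat) (D : Qp_raw -> Prop) (P : player) (s : state d) : Prop :=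
  match P with
  | Wanda => has_root_in p D s
  | Nora => ~ has_root_in p D s
  end.

Definition same_player (P Q : player) : bool :=
  match P, Q with Nora, Nora | Wanda, Wanda => true | _, _ => false end.

Fixpoint can_force (p d : nat) (D : Qp_raw -> Prop) (P : player) (k : nat)
  (mover : player) (s : state d) : Prop :=
  match k with
  | 0 => wins p D P s
  | k'.+1 =>
    if same_player mover P then
      exists i c, legal s i c /\ can_force p D P k' (other mover) (assign s i c)
    else
      forall i c, legal s i c -> can_force p D P k' (other mover) (assign s i c)
  end.

(* Main.v *)
Require Import Defs.
From mathcomp Require Import all_boot all_order all_algebra ring zify cyclic.
Set Implicit Arguments. Unset Strict Implicit. Unset Printing Implicit Defensive.
Import Order.TTheory GRing.Theory Num.Theory.
Local Open Scope ring_scope.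

(* If Wanda moves last she makes a natural number a root, one chosen not to be a root of the rest
   when her coefficient is an end one and must be nonzero.

   If Nora moves last, in position l, she makes |f(x)| >= |a_0| for the p-adic norm and all
   rational x, hence, by density, for all p-adic x. When l is 0, d, or 2 <= l <= d - 2 (and (d,
   l) <> (4, 2)), a coefficient of huge norm turns l into a vertex of the Newton polygon; its
   valuation can be chosen so that the at most two edges of the polygon have non-integral slope,
   and every f(x) then has a single term of largest norm. For a trinomial a_d x^d + c x^l + a_0
   she takes c = 0 if d does not divide v(a_0) - v(a_d); otherwise a rescaling makes the other
   two coefficients units, and she takes c in a residue class missed by r |-> -(a_d r^d + a_0) /
   r^l on F_p^*. The remaining positions l = 1 and l = d - 1 she avoids by filling them, with
   zeros, as early as she can; for d = 3, 4 this also leaves a trinomial whenever l = 2 comes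
   last. *)

(** * The [p]-adic norm on the rationals *)

Definition pnorm (p : nat) (x : rat) : rat :=
  if x == 0 then 0
  else p%:R ^ ((logn p `|denq x|)%:Z - (logn p `|numq x|)%:Z).

Section PadicNorm.

Variable p : nat.
Hypothesis p_pr : prime p.

Local Notation nrm := (pnorm p).

Let p_gt0 : (0 < p)%N. Proof. exact: prime_gt0. Qed.
Let pQ_gt0 : 0 < p%:R :> rat. Proof. by rewrite ltr0n. Qed.
Let pQ_gt1 : 1 < p%:R :> rat. Proof. by rewrite ltr1n prime_gt1. Qed.
Let pQ_neq0 : p%:R != 0 :> rat. Proof. by rewrite gt_eqF. Qed.

Lemma pnorm0 : nrm 0 = 0. Proof. by rewrite /pnorm eqxx. Qed.

(** Cross-multiplying with the reduced form shows that every fraction for the same number gives the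
    same exponent, so later computations need no reduced fractions. *)
Lemma pnorm_frac (a b : int) : a != 0 -> b != 0 ->
  nrm (a%:~R / b%:~R) = p%:R ^ ((logn p `|b|)%:Z - (logn p `|a|)%:Z).
Proof.
move=> a0 b0; have aQ : a%:~R != 0 :> rat by rewrite intr_eq0.
have bQ : b%:~R != 0 :> rat by rewrite intr_eq0.
set x := _ / _; have x0 : x != 0 by rewrite mulf_neq0 ?invr_eq0.
have cross : numq x * b = a * denq x.
  by apply: (@intr_inj rat); rewrite !intrM numqE mulrAC divfK.
have := congr1 (fun m => logn p `|m|%N) cross.
rewrite /pnorm (negbTE x0) !abszM !lognM ?absz_gt0 ?numq_eq0 ?denq_neq0 //.
by move=> E; congr (_ ^ _); lia.
Qed.

Lemma pnorm_neq0 (x : rat) : x != 0 -> exists m : int, nrm x = p%:R ^ m.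
Proof. by rewrite /pnorm => /negbTE ->; eexists. Qed.

Lemma pnorm_ge0 (x : rat) : 0 <= nrm x.
Proof. by rewrite /pnorm; case: ifP => // _; rewrite exprz_ge0 ?ltW. Qed.

Lemma pnorm_gt0 (x : rat) : x != 0 -> 0 < nrm x.
Proof. by rewrite /pnorm => /negbTE ->; rewrite exprz_gt0. Qed.

Lemma pnormM (x y : rat) : nrm (x * y) = nrm x * nrm y.
Proof.
have [->|x0] := eqVneq x 0; first by rewrite mul0r !pnorm0 mul0r.
have [->|y0] := eqVneq y 0; first by rewrite mulr0 !pnorm0 mulr0.
have nx := x0; have ny := y0; rewrite -numq_eq0 in nx; rewrite -numq_eq0 in ny.
rewrite -(divq_num_den x) -(divq_num_den y) mulf_div -!intrM.
rewrite !pnorm_frac ?mulf_neq0 ?denq_neq0 // -expfzDr //; congr (_ ^ _).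
rewrite !abszM !lognM ?absz_gt0 ?denq_neq0 //; lia.
Qed.

Lemma pnorm1 : nrm 1 = 1.
Proof. by have := @pnorm_frac 1 1; rewrite divr1 => -> //; rewrite subrr. Qed.

Lemma pnormN (x : rat) : nrm (- x) = nrm x.
Proof. by rewrite /pnorm oppr_eq0 numqN denqN abszN. Qed.

Lemma pnormX (x : rat) n : nrm (x ^+ n) = nrm x ^+ n.
Proof. by elim: n => [|n IH]; rewrite ?expr0 ?pnorm1 // !exprS pnormM IH. Qed.

Lemma pnormV (x : rat) : nrm (x^-1) = (nrm x)^-1.
Proof.
have [->|x0] := eqVneq x 0; first by rewrite pnorm0 !invr0 pnorm0.
apply: (mulfI (lt0r_neq0 (pnorm_gt0 x0))).
by rewrite -pnormM !divff ?pnorm1 // lt0r_neq0 ?pnorm_gt0.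
Qed.

Lemma pnorm_pexpn n : nrm (p%:R ^+ n) = p%:R ^- n.
Proof.
rewrite pnormX -exprVn; congr (_ ^+ _).
have p0 : (p%:Z != 0) by rewrite eqz_nat -lt0n.
have := @pnorm_frac p 1 p0 isT; rewrite divr1 => ->.
by rewrite /= logn1 logn_prime // eqxx.
Qed.

Lemma pnorm_pexpz (m : int) : nrm (p%:R ^ m) = p%:R ^ (- m).
Proof.
case: m => n; first by rewrite -exprnP pnorm_pexpn exprnN.
by rewrite NegzE -exprnN pnormV pnorm_pexpn invrK opprK -exprnP.
Qed.

Lemma pnorm_int (a : int) : a != 0 -> nrm a%:~R = p%:R ^- logn p `|a|.
Proof.
move=> a0; have := @pnorm_frac a 1 a0 isT; rewrite divr1 => ->.
by rewrite /= logn1 sub0r exprnN.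
Qed.

(** The link with [Qp_eq], which is phrased by divisibility. *)
Lemma pnorm_int_le (a : int) n :
  (nrm (a%:~R) <= p%:R ^- n) = (ppow p n %| a)%Z.
Proof.
have [->|a0] := eqVneq a 0; first by rewrite pnorm0 dvdz0 invr_ge0 exprn_ge0 ?ltW.
rewrite pnorm_int // !exprnN ler_eXz2l // lerN2 lez_nat -pfactor_dvdn ?absz_gt0 //.
by rewrite /ppow dvdzE abszX.
Qed.

Lemma pnorm_int_le1 (a : int) : nrm (a%:~R) <= 1.
Proof. by have := pnorm_int_le a 0; rewrite expr0 invr1 => ->; exact: dvd1z. Qed.

(** If [a] has the larger norm, the power of [p] in [a] divides [b] as well, hence the sum. *)
Lemma pnorm_intD (a b : int) :
  nrm (a%:~R + b%:~R) <= Num.max (nrm (a%:~R)) (nrm (b%:~R)).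
Proof.
wlog ab : a b / nrm (b%:~R) <= nrm (a%:~R).
  move=> W; case/orP: (le_total (nrm b%:~R) (nrm a%:~R)) => [/W//|/W].
  by rewrite addrC maxC.
rewrite max_l //; move: ab.
have [->|a0] := eqVneq a 0.
  have [->|b0] := eqVneq b 0; first by rewrite addr0.
  by rewrite pnorm0 leNgt pnorm_gt0 ?intr_eq0.
rewrite (pnorm_int a0) pnorm_int_le -intrD => bdiv.
by rewrite pnorm_int_le rpredD // -pnorm_int_le pnorm_int.
Qed.

Lemma pnormD (x y : rat) : nrm (x + y) <= Num.max (nrm x) (nrm y).
Proof.
rewrite -(divq_num_den x) -(divq_num_den y) addf_div ?intr_eq0 ?denq_neq0 //.
set D := (denq x)%:~R * (denq y)%:~R.
have -> : (numq x)%:~R / (denq x)%:~R = (numq x * denq y)%:~R / D.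
  by rewrite intrM /D -mulf_div [X in _ = _ * X]divff ?mulr1 ?intr_eq0 ?denq_neq0.
have -> : (numq y)%:~R / (denq y)%:~R = (numq y * denq x)%:~R / D.
  rewrite intrM /D [X in _ = _ / X]mulrC -mulf_div [X in _ = _ * X]divff ?mulr1 //.
  by rewrite intr_eq0 denq_neq0.
rewrite -!intrM !pnormM pnormV -maxr_pMl ?invr_ge0 ?pnorm_ge0 //.
by rewrite ler_wpM2r ?invr_ge0 ?pnorm_ge0 ?pnorm_intD.
Qed.

Lemma pnorm_sum_le (I : Type) (r : seq I) (P : pred I) (F : I -> rat) (M : rat) :
  0 <= M -> (forall i, P i -> nrm (F i) <= M) -> nrm (\sum_(i <- r | P i) F i) <= M.
Proof.
move=> M0 FM; elim/big_ind: _ => [|x y xM yM|//]; first by rewrite pnorm0.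
by apply: le_trans (pnormD x y) _; rewrite ge_max xM.
Qed.

Lemma pnorm_sum_lt (I : Type) (r : seq I) (P : pred I) (F : I -> rat) (M : rat) :
  0 < M -> (forall i, P i -> nrm (F i) < M) -> nrm (\sum_(i <- r | P i) F i) < M.
Proof.
move=> M0 FM; elim/big_ind: _ => [|x y xM yM|//]; first by rewrite pnorm0.
by apply: le_lt_trans (pnormD x y) _; rewrite gt_max xM.
Qed.

(** By the ultrametric inequality, [x = (x + y) - y] cannot have a larger norm than both of its
    terms. *)
Lemma pnormD_dominant (x y : rat) : nrm y < nrm x -> nrm (x + y) = nrm x.
Proof.
move=> yx; apply/eqP; rewrite eq_le; apply/andP; split.
  by apply: le_trans (pnormD x y) _; rewrite ge_max lexx ltW.
rewrite leNgt; apply/negP => lt; have := pnormD (x + y) (- y).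
by rewrite addrK pnormN leNgt gt_max lt yx.
Qed.

Lemma pnorm_sum_dominant (n : nat) (F : 'I_n -> rat) (i0 : 'I_n) :
  F i0 != 0 -> (forall i, i != i0 -> nrm (F i) < nrm (F i0)) ->
  nrm (\sum_i F i) = nrm (F i0).
Proof.
move=> F0 dom; rewrite (bigD1 i0) //=; apply/pnormD_dominant.
by apply: pnorm_sum_lt => //; rewrite pnorm_gt0.
Qed.

(** * Newton polygons with a single dominant term *)

(** Two classes modulo 2 may exhaust the integers, whence [4 < m + n]. Otherwise one modulus is at
    least 3, and its class meets four consecutive integers in at most one of them or in the two
    outer ones. Two adjacent integers remain, and they cannot both lie in the other class. *)
Lemma avoid_residues (m n : nat) (a b N : int) :
  (1 < m)%N -> (1 < n)%N -> (4 < m + n)%N ->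
  exists2 c : int, N <= c & ~~ (m%:Z %| c - a)%Z && ~~ (n%:Z %| c - b)%Z.
Proof.
move=> m1 n1 mn.
have step (q : nat) (x : int) (i j : nat) : (j < i)%N -> (i - j < q)%N ->
    (q%:Z %| N + i%:Z - x)%Z -> (q%:Z %| N + j%:Z - x)%Z -> False.
  move=> ji ijq di dj.
  have : (q%:Z %| i%:Z - j%:Z)%Z.
    by have := rpredB di dj; rewrite (_ : _ - _ = i%:Z - j%:Z) //; ring.
  by rewrite subzn ?(ltnW ji) // dvdzE /= gtnNdvd // subn_gt0.
pose P i := (m%:Z %| N + i%:Z - a)%Z; pose Q i := (n%:Z %| N + i%:Z - b)%Z.
have [//|none] := boolP (has (fun i => ~~ P i && ~~ Q i) (iota 0 4)).
  by case/hasP=> i _ PQ; exists (N + i%:Z); rewrite ?lerDl.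
have Pm i j : (j < i)%N -> (i - j < m)%N -> P i -> P j -> False by exact: step.
have Qn i j : (j < i)%N -> (i - j < n)%N -> Q i -> Q j -> False by exact: step.
exfalso; move: none Pm Qn; move: P Q => P Q {step}; rewrite /= orbF.
wlog m2 : m n P Q m1 n1 mn / (2 < m)%N.
  move=> W; have [m2|m2] := ltnP 2 m; first exact: (W m n P Q).
  move=> none Pm Qn; have n2 : (2 < n)%N by move: mn m2; clear; lia.
  apply: (W n m Q P) => //; first by rewrite addnC.
  by move: none; rewrite ![~~ Q _ && _]andbC.
rewrite !negb_or !negb_and !negbK => /and4P[h0 h1 h2 h3] Pm Qn.
have P01 := Pm 1 0 isT m1; have P12 := Pm 2 1 isT m1.
have P23 := Pm 3 2 isT m1; have P02 := Pm 2 0 isT m2; have P13 := Pm 3 1 isT m2.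
have Q01 := Qn 1 0 isT n1; have Q12 := Qn 2 1 isT n1; have Q23 := Qn 3 2 isT n1.
by case: (P 0) (P 1) (P 2) (P 3) h0 h1 h2 h3 P01 P12 P23 P02 P13 => [] [] [] [] /=; tauto.
Qed.
(* For |x| <= t the terms strictly between 0 and l are dominated by the constant term, for |x| > t by
   the l-th term; symmetrically beyond l, with the threshold 1 / t. *)
Lemma pnorm_le_dominant (d l : nat) (f : nat -> rat) (t : rat) :
  (l <= d)%N -> 0 < t -> t <= 1 -> f 0 != 0 -> f l != 0 -> f d != 0 ->
  (forall j, (0 < j < l)%N -> nrm (f j) * t < nrm (f 0)) ->
  (forall j, (l < j < d)%N -> nrm (f j) * t < nrm (f d)) ->
  (forall j, (j <= d)%N -> j != l -> nrm (f j) < nrm (f l) * t ^+ d) ->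
  (forall x, (0 < l)%N -> x != 0 -> nrm (f l * x ^+ l) != nrm (f 0)) ->
  (forall x, (l < d)%N -> x != 0 ->
     nrm (f l * x ^+ l) != nrm (f d * x ^+ d)) ->
  forall x, nrm (f 0) <= nrm (\sum_(j < d.+1) f j * x ^+ j).
Proof.
move=> ld t0 t1 f0 fl fd low high top slope0 sloped x.
have [->|x0] := eqVneq x 0.
  rewrite big_ord_recl expr0 mulr1 big1 ?addr0 // => i _.
  by rewrite expr0n /= mulr0.
have z0 := pnorm_gt0 x0; set z := nrm x in z0.
pose T j := nrm (f j) * z ^+ j.
have TE j : nrm (f j * x ^+ j) = T j by rewrite pnormM pnormX.
have T0E : T 0 = nrm (f 0) by rewrite /T expr0 mulr1.
have zX j : 0 < z ^+ j by rewrite exprn_gt0.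
have tX j : 0 < t ^+ j by rewrite exprn_gt0.
have fle j : (j <= d)%N -> j != l -> nrm (f j) < nrm (f l).
  move=> jd jl; apply: lt_le_trans (top j jd jl) _.
  by rewrite ler_piMr ?pnorm_ge0 // exprn_ile1 // ltW.
have below j : (0 < j < l)%N -> T j < Num.max (T 0) (T l).
  move=> /andP[j0 jl]; rewrite lt_max T0E /T; have [zt|tz] := leP z t.
    apply/orP; left; apply: le_lt_trans (low j _); last by rewrite j0.
    by rewrite ler_wpM2l ?pnorm_ge0 // (le_trans _ zt) // ler_iXnr ?(le_trans zt t1) // ltW.
  have jd : (j <= d)%N by apply: leq_trans ld; exact: ltnW.
  apply/orP; right; rewrite -{2}(subnK (ltnW jl)) exprD mulrA ltr_pM2r //.
  apply: lt_le_trans (top j jd _) _; first by rewrite neq_ltn jl.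
  rewrite ler_wpM2l ?pnorm_ge0 //.
  apply: le_trans (_ : t ^+ (l - j) <= _).
    by rewrite ler_wiXn2l ?(ltW t0) // (leq_trans (leq_subr _ _)).
  by rewrite lerXn2r ?nnegrE ?ltW.
have above j : (l < j < d)%N -> T j < Num.max (T l) (T d).
  move=> /andP[lj jd]; rewrite lt_max /T; have [tz|zt] := leP 1 (z * t).
    have z1 : 1 <= z by apply: le_trans tz _; rewrite ler_piMr // ltW.
    apply/orP; right; rewrite -{2}(subnK (ltnW jd)) exprD mulrA ltr_pM2r //.
    rewrite -(ltr_pM2r t0); apply: lt_le_trans (high j _) _; first by rewrite lj.
    rewrite -mulrA ler_peMr ?pnorm_ge0 // (le_trans tz) // ler_pM2r //.
    by rewrite ler_eXnr // subn_gt0.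
  apply/orP; left; rewrite -{2}(subnK (ltnW lj)) exprD mulrA ltr_pM2r //.
  rewrite -(ltr_pM2r (tX d)); apply: le_lt_trans (top j (ltnW jd) _); last first.
    by rewrite neq_ltn lj orbT.
  rewrite -mulrA ler_piMr ?pnorm_ge0 //.
  apply: le_trans (_ : (z * t) ^+ (j - l) <= _); last first.
    by rewrite exprn_ile1 ?mulr_ge0 // ltW.
  by rewrite exprMn ler_pM2l // ler_wiXn2l ?(ltW t0) // (leq_trans (leq_subr _ _)) // ltnW.
(* For [l] distinct from the end in question, [T d] reaches [T l] only if [z > 1], and [T 0] only if
   [z < 1]; so the two ends never both do. *)
have small : l != d -> z <= 1 -> T d < T l.
  move=> ld' z1; apply: lt_le_trans (_ : nrm (f l) * z ^+ d <= _).
    by rewrite ltr_pM2r // fle // eq_sym.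
  by rewrite ler_wpM2l ?pnorm_ge0 // ler_wiXn2l // ltW.
have large : l != 0 -> 1 <= z -> T 0 < T l.
  move=> l0 z1; apply: lt_le_trans (_ : nrm (f l) <= _).
    by rewrite T0E fle // eq_sym.
  by rewrite ler_peMr ?pnorm_ge0 // exprn_ege1.
(* A strictly largest term gives the sum its norm, which is then at least [T 0]. The hypotheses on
   slopes exclude ties of [T l] with [T 0] and [T d], so one of these three is the strict
   maximum. *)
suff [j0 dom] : exists j0 : 'I_d.+1, forall j : 'I_d.+1, j != j0 -> T j < T j0.
  have T0 : T 0 <= T j0.
    by have [<-//|/dom/ltW] := eqVneq ord0 j0.
  have Tj0 : 0 < T j0 by apply: lt_le_trans T0; rewrite T0E pnorm_gt0.
  rewrite (@pnorm_sum_dominant _ _ j0).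
  - by rewrite TE -T0E.
  - by apply/eqP => E; move: Tj0; rewrite -TE E pnorm0 ltxx.
  - by move=> j /dom; rewrite !TE.
have [/andP[l0 Tl0]|N0] := boolP ((l != 0) && (T l < T 0)).
  exists ord0 => -[j jd] /= j0; rewrite -val_eqE /= in j0.
  have z1 : z < 1 by rewrite ltNge; apply/negP => /(large l0); rewrite ltNge ltW.
  have Td : T d <= T l.
    by have [->//|/small/(_ (ltW z1))/ltW] := eqVneq l d.
  have [jl|lj|->//] := ltngtP j l.
    have := below j; rewrite lt0n j0 jl => /(_ isT).
    by rewrite max_l // ltW.
  have [jd'|dj] := ltnP j d.
    have := above j; rewrite lj jd' => /(_ isT).
    by rewrite max_l // => /lt_trans; apply.
  have -> : j = d by apply/eqP; rewrite eqn_leq dj -ltnS jd.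
  exact: le_lt_trans Td Tl0.
have T0l : T 0 <= T l.
  move: N0; rewrite negb_and negbK -leNgt => /orP[/eqP->|] //.
have T0l' : l != 0 -> T 0 < T l.
  move=> l0; rewrite lt_neqAle T0l andbT eq_sym T0E -TE; apply: slope0 => //.
  by rewrite lt0n.
have [/andP[ld' Tld]|Nd] := boolP ((l != d) && (T l < T d)).
  exists ord_max => -[j jd] /= j0; rewrite -val_eqE /= in j0.
  have {}jd : (j < d)%N by rewrite ltn_neqAle j0 -ltnS.
  have [jl|lj|->//] := ltngtP j l; last first.
    have := above j; rewrite lj jd => /(_ isT).
    by rewrite max_r // ltW.
  apply: lt_trans Tld; have [->|j0'] := eqVneq j 0.
    by apply: T0l'; rewrite -lt0n (leq_ltn_trans _ jl).
  have := below j; rewrite lt0n j0' jl => /(_ isT).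
  by rewrite max_r.
have Tdl' : l != d -> T d < T l.
  move=> ld'; move: Nd; rewrite ld' /= -leNgt => Tdl.
  rewrite lt_neqAle Tdl andbT eq_sym -!TE; apply: sloped => //.
  by rewrite ltn_neqAle ld'.
exists (inord l) => -[j jd] /=; rewrite -val_eqE /= inordK ?ltnS // => jl.
have [{}jl|lj|E] := ltngtP j l; last by rewrite E eqxx in jl.
  have [->|j0] := eqVneq j 0; first by apply: T0l'; rewrite -lt0n (leq_ltn_trans _ jl).
  have := below j; rewrite lt0n j0 jl => /(_ isT).
  by rewrite max_r.
have [jd'|] := ltnP j d.
  have := above j; rewrite lj jd' => /(_ isT).
  by rewrite max_l //; apply/ltW/Tdl'; rewrite neq_ltn (ltn_trans lj).
move=> dj; have -> : j = d by apply/eqP; rewrite eqn_leq dj -ltnS jd.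
by apply: Tdl'; rewrite neq_ltn (leq_trans lj) // -ltnS.
Qed.

(** * Congruences modulo [p] and trinomials *)

(** The denominator of [y] is prime to [p], and a Bezout relation inverts it modulo [p]. *)
Lemma pnorm_congr_int (y : rat) : nrm y <= 1 -> exists r : int, nrm (y - r%:~R) < 1.
Proof.
move=> y1; have pd : ~~ (p %| `|denq y|)%N.
  apply/negP => pd; have y0 : y != 0.
    apply/eqP => y0; move: pd; rewrite y0 dvdn1 => /eqP p1.
    by move: p_pr; rewrite p1.
  have d1 : (0 < logn p `|denq y|)%N by rewrite logn_gt0 mem_primes p_pr absz_gt0 denq_neq0.
  move: y1; rewrite /pnorm (negbTE y0) -[X in _ <= X](expr0z (p%:R : rat)) ler_eXz2l // => le.
  have : (0 < logn p `|numq y|)%N by lia.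
  rewrite logn_gt0 mem_primes p_pr absz_gt0 numq_eq0 y0 /= => pn.
  have := coprime_num_den y; rewrite /coprime => /eqP cop.
  have : (p %| gcdn `|numq y| `|denq y|)%N by rewrite dvdn_gcd pn.
  by rewrite cop dvdn1 => /eqP p1; move: p_pr; rewrite p1.
have cop : coprimez (denq y) p by rewrite coprimezE /= coprime_sym prime_coprime.
have [[u v] uv] := coprimezP _ _ cop.
exists (numq y * u); rewrite -{1}(divq_num_den y).
have dQ : (denq y)%:~R != 0 :> rat by rewrite intr_eq0 denq_neq0.
have -> : (numq y)%:~R / (denq y)%:~R - (numq y * u)%:~R =
   ((numq y * v)%:~R * p%:R ^+ 1) / (denq y)%:~R :> rat.
  have uvQ : u%:~R * (denq y)%:~R + v%:~R * p%:R = 1 :> rat.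
    by rewrite -[p%:R]/(p%:Z%:~R) -!intrM -intrD uv.
  apply: (mulIf dQ); rewrite mulrBl !divfK // !intrM.
  rewrite -[LHS]/(_ - _) -{1}[(numq y)%:~R]mulr1 -{1}uvQ expr1; ring.
rewrite !pnormM pnormV pnorm_pexpn (_ : nrm (denq y)%:~R = 1).
  rewrite invr1 mulr1 expr1; apply: le_lt_trans (_ : p%:R^-1 < 1); last by rewrite invf_lt1.
  by rewrite ler_piMl ?pnorm_int_le1 ?invr_ge0 ?ltW.
by rewrite pnorm_int ?denq_neq0 // lognE (negbTE pd) !andbF expr0 invr1.
Qed.

(** Here [nrm (a - b) < 1] plays the part of congruence modulo [p]. *)
Lemma pnorm_congrM (a b c e : rat) : nrm b <= 1 -> nrm c <= 1 ->
  nrm (a - b) < 1 -> nrm (c - e) < 1 -> nrm (a * c - b * e) < 1.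
Proof.
move=> b1 c1 ab ce; have -> : a * c - b * e = (a - b) * c + b * (c - e) by ring.
apply: le_lt_trans (pnormD _ _) _; rewrite gt_max !pnormM.
apply/andP; split.
  by apply: le_lt_trans ab; rewrite ler_piMr ?pnorm_ge0.
by apply: le_lt_trans ce; rewrite ler_piMl ?pnorm_ge0.
Qed.

Lemma pnorm_congrX (a b : rat) n : nrm a <= 1 -> nrm b <= 1 ->
  nrm (a - b) < 1 -> nrm (a ^+ n - b ^+ n) < 1.
Proof.
move=> a1 b1 ab; elim: n => [|n IH]; first by rewrite subrr pnorm0.
by rewrite !exprS; apply: pnorm_congrM => //; rewrite pnormX exprn_ile1 ?pnorm_ge0.
Qed.

(* r |-> -(1 + u r^d) / r^l misses some w because F_p^* has fewer than p elements. *)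
Lemma exists_missed_residue (u : 'F_p) (d l : nat) :
  exists w : nat, forall r : 'F_p, r != 0 -> 1 + u * r ^+ d + w%:R * r ^+ l != 0.
Proof.
pose h (r : 'F_p) := - (1 + u * r ^+ d) / r ^+ l.
have [w wh] : exists w, w \notin [set h r | r in [set~ 0]].
  apply/existsP; rewrite -negb_forall; apply/negP => /forallP all.
  have : (#|'F_p| <= #|[set~ (0%R : 'F_p)]|)%N.
    apply: leq_trans (leq_imset_card h _); rewrite -cardsT subset_leq_card //.
    by apply/subsetP => x _; exact: all.
  by rewrite cardsC1; have := prime_gt0 p_pr; rewrite card_Fp //; lia.
exists (val w) => r r0; apply: contra wh => /eqP E; apply/imsetP; exists r.
  by rewrite !inE.
have rl0 : r ^+ l != 0 by rewrite expf_neq0.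
have wE : (val w)%:R = w :> 'F_p by rewrite natr_Zp.
by apply: (mulIf rl0); rewrite /h divfK // -{1}wE -(addr0 (- _)) -E; ring.
Qed.

(** The constant term dominates if [nrm y < 1], the leading term if [nrm y > 1]. If [nrm y = 1],
    then [y] reduces to a nonzero class modulo [p], where the choice of [w] keeps the reduced
    trinomial from vanishing. *)
Lemma trinomial_unit_dominated (u : rat) (d l : nat) : nrm u = 1 -> (0 < l < d)%N ->
  exists w : nat, forall y, 1 <= nrm (1 + u * y ^+ d + w%:R * y ^+ l).
Proof.
move=> u1 /andP[l0 ld]; have [|U uU] := @pnorm_congr_int u; first by rewrite u1.
have [w wP] := exists_missed_residue U%:~R d l; exists w => y.
have w1 : nrm w%:R <= 1 by rewrite -[w%:R]/(w%:Z%:~R) pnorm_int_le1.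
have y0 := pnorm_ge0 y; have [ylt1|ygt1|y1] := ltgtP (nrm y) 1.
- rewrite -addrA pnormD_dominant pnorm1 //; apply: le_lt_trans (pnormD _ _) _.
  rewrite gt_max !pnormM u1 mul1r !pnormX exprn_ilt1 ?gtn_eqF ?(ltn_trans l0) //=.
  apply: le_lt_trans (_ : nrm y ^+ l < 1); first by rewrite ler_piMl ?exprn_ge0.
  by rewrite exprn_ilt1 // -lt0n.
- have dl : nrm y ^+ l < nrm y ^+ d by rewrite ltr_eXn2l.
  have -> : 1 + u * y ^+ d + w%:R * y ^+ l = u * y ^+ d + (1 + w%:R * y ^+ l) by ring.
  rewrite pnormD_dominant pnormM u1 mul1r pnormX ?exprn_ege1 ?ltW //.
  apply: le_lt_trans (pnormD _ _) _; rewrite gt_max pnorm1.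
  rewrite exprn_egt1 ?gtn_eqF ?(ltn_trans l0) //= pnormM pnormX.
  by apply: le_lt_trans dl; rewrite ler_piMl ?exprn_ge0.
have [|r yr] := @pnorm_congr_int y; first by rewrite y1.
have ri := pnorm_int_le1 r; have Ui := pnorm_int_le1 U.
set F := _ + _.
have FG : nrm (F - (1 + U * r ^+ d + w%:Z * r ^+ l)%:~R) < 1.
  rewrite /F !intrD !intrM !rmorphXn /= -[w%:~R]/(w%:R).
  have -> : 1 + u * y ^+ d + w%:R * y ^+ l - (1 + U%:~R * r%:~R ^+ d + w%:R * r%:~R ^+ l)
    = (u * y ^+ d - U%:~R * r%:~R ^+ d) + (w%:R * y ^+ l - w%:R * r%:~R ^+ l) by ring.
  apply: le_lt_trans (pnormD _ _) _; rewrite gt_max; apply/andP; split.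
    apply: pnorm_congrM => //; first by rewrite pnormX y1 expr1n.
    by apply: pnorm_congrX => //; rewrite y1.
  apply: pnorm_congrM => //; first by rewrite pnormX y1 expr1n.
    by rewrite subrr pnorm0.
  by apply: pnorm_congrX => //; rewrite y1.
have lt1 (a : int) : (nrm a%:~R < 1) = (a%:~R == 0 :> 'F_p).
  rewrite -(dvdz_pcharf (pchar_Fp p_pr)); have [->|a0] := eqVneq a 0.
    by rewrite pnorm0 ltr01 dvdz0.
  rewrite pnorm_int // -exprVn dvdzE /=; have [pa|pa] := boolP (p %| `|a|)%N.
    have : (0 < logn p `|a|)%N by rewrite logn_gt0 mem_primes p_pr absz_gt0 a0.
    by rewrite lt0n => n0; rewrite exprn_ilt1 ?invr_ge0 ?ltW ?invf_lt1.
  by rewrite lognE (negbTE pa) !andbF expr0 ltxx.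
have rF : r%:~R != 0 :> 'F_p.
  rewrite -lt1 -leNgt leNgt; apply/negP => r1.
  have := pnormD (y - r%:~R) r%:~R; rewrite subrK y1 le_max leNgt yr /=.
  by rewrite leNgt r1.
have := wP _ rF; rewrite leNgt => /negP GF; apply/negP => F1; apply: GF.
suff : (1 + U * r ^+ d + w%:Z * r ^+ l)%:~R == 0 :> 'F_p.
  by rewrite !intrD !intrM !rmorphXn.
rewrite -lt1; have := pnormD F (- (F - (1 + U * r ^+ d + w%:Z * r ^+ l)%:~R)).
by rewrite pnormN subKr; move/le_lt_trans; apply; rewrite gt_max F1.
Qed.

(** * Nora's last coefficient *)

Lemma exists_pexpz_gt (M : rat) : exists N : nat, M < p%:R ^+ N.
Proof.
exists (Num.bound M); have [M0|M0] := ltP M 0.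
  by apply: lt_le_trans M0 _; rewrite exprn_ge0 // ltW.
apply: lt_le_trans (archi_boundP M0) _; rewrite -natrX ler_nat ltnW //.
exact/ltn_expl/prime_gt1.
Qed.


Definition set_coef (a : nat -> rat) (l : nat) (c : rat) (j : nat) : rat :=
  if j == l then c else a j.

(** The edges at the vertex [l] have widths [l] and [d - l], and non-integral slopes mean that the
    valuation of [c] avoids one residue class modulo each width. Width 1 leaves no class, and two
    widths 2 may leave none: these are the excluded positions. *)
Lemma huge_coefficient (d l : nat) (a : nat -> rat) :
  (1 < d)%N -> (l <= d)%N -> l != 1 -> l.+1 != d -> ~~ ((d == 4) && (l == 2)) ->
  (l != 0 -> a 0 != 0) -> (l != d -> a d != 0) ->
  exists2 c : rat, c != 0 & forall x,
    nrm (set_coef a l c 0) <= nrm (\sum_(j < d.+1) set_coef a l c j * x ^+ j).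
Proof.
move=> d1 ld l1 ld1 ld2 a0 ad.
pose q0 := if l == 0 then 1 else nrm (a 0).
pose qd := if l == d then 1 else nrm (a d).
have q0_gt0 : 0 < q0 by rewrite /q0; case: eqVneq => // /a0; exact: pnorm_gt0.
have qd_gt0 : 0 < qd by rewrite /qd; case: eqVneq => // /ad; exact: pnorm_gt0.
pose M := 1 + \sum_(j < d.+1) nrm (a j).
have M1 : 1 <= M by rewrite lerDl sumr_ge0 // => j _; exact: pnorm_ge0.
have M0 : 0 < M by apply: lt_le_trans M1.
have aM j : (j <= d)%N -> nrm (a j) < M.
  move=> jd; rewrite /M (bigD1 (Ordinal (jd : j < d.+1)%N)) //= addrCA ltrDl.
  by rewrite ltr_wpDr ?ltr01 // sumr_ge0 // => i _; exact: pnorm_ge0.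
(* [q] is at most the norm of each end other than [l], and [t] is so small that [nrm (a j) * t < q]
   for all [j]; the 1 in the minimum gives [t <= 1]. *)
pose q := Num.min 1 (Num.min q0 qd); pose t := q / M.
have q_gt0 : 0 < q by rewrite !lt_min ltr01 q0_gt0.
have [q1 [qq0 qqd]] : q <= 1 /\ q <= q0 /\ q <= qd by rewrite !ge_min !lexx ?orbT.
have t0 : 0 < t by rewrite divr_gt0.
have t1 : t <= 1 by rewrite ler_pdivrMr // mul1r (le_trans q1).
have tlow j : (j <= d)%N -> nrm (a j) * t < q.
  by move=> jd; rewrite /t mulrCA gtr_pMr // ltr_pdivrMr // mul1r aM.
have [N MN] := exists_pexpz_gt (M / t ^+ d).
have [A EA] : exists A : int, l != 0 -> nrm (a 0) = p%:R ^ A.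
  by have [_|/a0/pnorm_neq0[A ->]] := eqVneq l 0; [exists 0 | exists A].
have [B EB] : exists B : int, l != d -> nrm (a d) = p%:R ^ B.
  by have [_|/ad/pnorm_neq0[B ->]] := eqVneq l d; [exists 0 | exists B].
(* If [l] is an end, one edge is missing; the dummy modulus 3 then makes the sum of the moduli
   exceed 4, since the other modulus is [d]. *)
have [|||C NC /andP[CA CB]] := @avoid_residues
    (if l == 0 then 3%N else l) (if l == d then 3%N else d - l)%N A B N.
- by move: l1; clear; case: l => [|[|l]].
- by case: (eqVneq l d) => // ld'; move: ld ld' ld1; clear; lia.
- move: d1 ld l1 ld1 ld2; clear.
  by case: (eqVneq l d) => [->|ld']; case: (eqVneq _ 0%N) => [|l0] *; lia.
pose c : rat := p%:R ^ (- C).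
have nc : nrm c = p%:R ^ C by rewrite pnorm_pexpz opprK.
have c0 : c != 0 by rewrite expfz_neq0.
exists c => //; have fl : set_coef a l c l = c by rewrite /set_coef eqxx.
have fj j : j != l -> set_coef a l c j = a j by rewrite /set_coef => /negbTE ->.
have slope k (m : int) (x : rat) : nrm x = p%:R ^ m ->
    nrm (c * x ^+ k) = p%:R ^ (C + m * k%:Z).
  by move=> xm; rewrite pnormM pnormX nc xm exprnP exprz_exp -expfzDr.
have pinj : injective (fun m : int => p%:R ^ m : rat).
  by move=> m n; apply: ieexprIz; rewrite ?gt_eqF.
apply: (@pnorm_le_dominant d l _ t) => //.
- by have [E|l0] := eqVneq 0%N l; rewrite /set_coef;
    [rewrite -E eqxx | rewrite (negbTE l0) a0 // eq_sym].
- by rewrite fl.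
- by have [E|l0] := eqVneq d l; rewrite /set_coef;
    [rewrite -E eqxx | rewrite (negbTE l0) ad // eq_sym].
- move=> j /andP[j0 jl]; have l0 : l != 0 by rewrite -lt0n (ltn_trans j0).
  rewrite (fj j) ?neq_ltn ?jl // (fj 0%N) 1?eq_sym //.
  apply: lt_le_trans (tlow j _) _; first by rewrite (leq_trans (ltnW jl)).
  by apply: le_trans qq0 _; rewrite /q0 (negbTE l0).
- move=> j /andP[lj jd]; have l0 : l != d by rewrite neq_ltn (ltn_trans lj).
  rewrite (fj j) ?neq_ltn ?lj ?orbT // (fj d) 1?eq_sym //.
  apply: lt_le_trans (tlow j _) _; first by rewrite ltnW.
  by apply: le_trans qqd _; rewrite /qd (negbTE l0).
- move=> j jd jl; rewrite fj // fl nc; apply: lt_trans (aM j jd) _.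
  rewrite -ltr_pdivrMr ?exprn_gt0 //; apply: lt_le_trans MN _.
  by rewrite exprnP ler_eXz2l.
- move=> x l0 /pnorm_neq0[m xm]; rewrite fl fj ?EA -?lt0n // 1?eq_sym -?lt0n //.
  rewrite (slope _ m x) //; apply: contra CA => /eqP/pinj ->.
  by rewrite opprD addrA subrr sub0r rpredN eqn0Ngt l0 dvdz_mull.
move=> x l0 /pnorm_neq0[m xm]; have l0' : l != d by rewrite neq_ltn l0.
rewrite fl fj 1?eq_sym // (slope _ m x) // pnormM pnormX EB // xm exprnP exprz_exp.
rewrite -expfzDr //; apply: contra CB => /eqP/pinj E.
rewrite (negbTE l0') (_ : C - B = m * (d - l)%N%:Z) ?dvdz_mull //.
by rewrite -subzn // mulrBr; move: E; clear; lia.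
Qed.

Lemma trinomial_coefficient (d l : nat) (a : nat -> rat) :
  (0 < l < d)%N -> a 0 != 0 -> a d != 0 ->
  (forall j, (0 < j < d)%N -> j != l -> a j = 0) ->
  exists c : rat, forall x,
    nrm (set_coef a l c 0) <= nrm (\sum_(j < d.+1) set_coef a l c j * x ^+ j).
Proof.
move=> /andP[l0 ld] a0 ad aj.
have sumE c x : \sum_(j < d.+1) set_coef a l c j * x ^+ j =
    a 0 + a d * x ^+ d + c * x ^+ l.
  have l0' : l != 0 by rewrite -lt0n.
  have ld' : l != d by rewrite neq_ltn ld.
  rewrite (bigD1 ord0) //= (bigD1 ord_max) /=; last by rewrite -val_eqE /= -lt0n (ltn_trans l0).
  have ldS : (l < d.+1)%N by rewrite ltnW.
  rewrite (bigD1 (Ordinal ldS)) /=; last by rewrite -!val_eqE /= l0' ld'.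
  rewrite big1 => [|j /andP[/andP[]]].
    by rewrite /set_coef !(eq_sym _ l) (negbTE l0') (negbTE ld') eqxx expr0 mulr1 addr0 addrA.
  rewrite -!val_eqE /= => j0 jd jl; rewrite /set_coef (negbTE jl) aj ?mul0r //.
  by rewrite lt0n j0 ltn_neqAle jd -ltnS ltn_ord.
have E0 c : set_coef a l c 0 = a 0 by rewrite /set_coef eq_sym (gtn_eqF l0).
have d0 : (0 < d)%N by apply: ltn_trans ld.
have [A EA] := pnorm_neq0 a0; have [B EB] := pnorm_neq0 ad.
(* A tie between [a d * x ^+ d] and [a 0] would make [A - B] a multiple of [d]. *)
have [/dvdzP[s AB]|AB] := boolP (d%:Z %| A - B)%Z; last first.
  exists 0 => x; rewrite sumE E0 mul0r addr0.
  have [->|x0] := eqVneq x 0; first by rewrite expr0n gtn_eqF // mulr0 addr0.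
  have ne : nrm (a d * x ^+ d) != nrm (a 0).
    have [m xm] := pnorm_neq0 x0; rewrite pnormM pnormX EA EB xm exprnP exprz_exp.
    rewrite -expfzDr //; apply: contra AB => /eqP/ieexprIz E.
    by rewrite -E ?gt_eqF // addrAC subrr add0r dvdz_mull.
  have [lt|gt|/eqP E] := ltgtP (nrm (a d * x ^+ d)) (nrm (a 0)).
  - by rewrite pnormD_dominant.
  - by rewrite addrC pnormD_dominant // ltW.
  - by rewrite E in ne.
(* Since [s] is [(A - B) / d], substituting [x = x0 * y] and dividing by [a 0] turns the end
   coefficients into [u], of norm 1, and 1. *)
pose x0 : rat := p%:R ^ (- s).
have x0_neq0 : x0 != 0 by rewrite expfz_neq0.
pose u := a d * x0 ^+ d / a 0.
have u1 : nrm u = 1.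
  rewrite /u !pnormM pnormV pnormX pnorm_pexpz opprK EA EB exprnP exprz_exp.
  by rewrite -expfzDr // -AB addrC subrK divff // expfz_neq0.
have [|w wP] := @trinomial_unit_dominated u d l u1; first by rewrite l0.
(* This undoes the rescaling: the middle coefficient becomes [w] in the variable [x / x0]. *)
exists (w%:R * a 0 / x0 ^+ l) => x; rewrite sumE E0.
have -> : a 0 + a d * x ^+ d + w%:R * a 0 / x0 ^+ l * x ^+ l =
    a 0 * (1 + u * (x / x0) ^+ d + w%:R * (x / x0) ^+ l).
  rewrite /u !exprMn !exprVn; field.
  by rewrite a0 !expf_neq0.
by rewrite pnormM ler_peMr ?pnorm_ge0.
Qed.

End PadicNorm.

(* The rational number represented by the n-th approximation; it is compatible with the operations
   exactly, not only up to p^n. *)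
Definition approx (p : nat) (z : Qp_raw) (n : nat) : rat :=
  (z.2 n)%:~R / p%:R ^+ z.1.

(** * From values at rational points to roots in the [p]-adic numbers *)

Section Approximants.

Variable p : nat.
Hypothesis p_pr : prime p.

Local Notation nrm := (pnorm p).

Let pQ_gt0 : 0 < p%:R :> rat. Proof. by rewrite ltr0n prime_gt0. Qed.
Let pX_neq0 n : p%:R ^+ n != 0 :> rat. Proof. by rewrite expf_neq0 ?gt_eqF. Qed.

Lemma ppowQ n : (ppow p n)%:~R = p%:R ^+ n :> rat.
Proof. by rewrite /ppow rmorphXn. Qed.

Lemma approx_add (y z : Qp_raw) n :
  approx p (Qp_add p y z) n = approx p y n + approx p z n.
Proof.
rewrite /approx /= rmorphD !rmorphM /= !ppowQ addf_div // exprD.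
by congr (_ / _); ring.
Qed.

Lemma approx_mul (y z : Qp_raw) n :
  approx p (Qp_mul y z) n = approx p y n * approx p z n.
Proof. by rewrite /approx /= rmorphM mulf_div exprD. Qed.

Lemma approx_pow (z : Qp_raw) i n : approx p (Qp_pow z i) n = approx p z n ^+ i.
Proof.
elim: i => [|i IH]; first by rewrite /approx /= divr1.
by rewrite exprS -IH -approx_mul.
Qed.

Lemma approx_eval_state (d : nat) (s : state d) (x : Qp_raw) n :
  approx p (eval_state p s x) n =
  \sum_(i < d.+1) approx p (Qp_of_rat p (odflt 0 (s i))) n * approx p x n ^+ i.
Proof.
rewrite -[RHS]big_enum /eval_state /=; elim: (enum _) => [|i r IH].
  by rewrite big_nil /approx /= mul0r.
by rewrite big_cons -IH /= approx_add approx_mul approx_pow.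
Qed.

(** By Euler's theorem [c ^ (totient (p ^ n)).-1] inverts [c] modulo [p ^ n]; the division by
    [p ^ v] costs the factor in the numerator of the bound. *)
Lemma approx_of_rat (q : rat) n :
  nrm (approx p (Qp_of_rat p q) n - q) <= p%:R ^+ (Qp_of_rat p q).1 / p%:R ^+ n.
Proof.
rewrite /approx /Qp_of_rat /=; set b := `|denq q|%N; set v := logn p b.
have b0 : (0 < b)%N by rewrite absz_gt0 denq_neq0.
set c := (b %/ p ^ v)%N; have bE : b = (c * p ^ v)%N by rewrite divnK // pfactor_dvdnn.
have cp : ~~ (p %| c)%N.
  apply/negP => /dvdnP[e ce]; have : (p ^ v.+1 %| b)%N.
    by rewrite bE ce -mulnA -expnS dvdn_mull.
  by rewrite pfactor_dvdn // ltnn.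
have c0 : (0 < c)%N by rewrite lt0n; apply: contra cp => /eqP->.
have cQ : c%:R != 0 :> rat by rewrite pnatr_eq0 -lt0n.
have qE : q = (numq q)%:~R / (c%:R * p%:R ^+ v).
  rewrite -[LHS]divq_num_den; congr (_ / _).
  by rewrite -(gez0_abs (ltW (denq_gt0 q))) -/b bE -pmulrn natrM natrX.
have phi0 : (0 < totient (p ^ n))%N by rewrite totient_gt0 expn_gt0 prime_gt0.
set f := totient _ in phi0 *.
have euler : nrm (c%:R ^+ f - 1) <= p%:R ^- n.
  have -> : c%:R ^+ f - 1 = ((c ^ f)%N%:Z - 1)%:~R :> rat.
    by rewrite rmorphB /= -pmulrn natrX.
  have cf0 : (0 < c ^ f)%N by rewrite expn_gt0 c0.
  rewrite pnorm_int_le // /ppow subzn // dvdzE abszX /= -eqn_mod_dvd //.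
  by rewrite Euler_exp_totient // coprimeXr // coprime_sym prime_coprime.
have -> : (numq q * (c ^ f.-1)%N)%:~R / p%:R ^+ v - q =
    (numq q)%:~R * (p%:R ^- v * (c%:R^-1 * (c%:R ^+ f - 1))) :> rat.
  rewrite [X in _ - X]qE intrM -pmulrn natrX -{2}(prednK phi0) exprS; field.
  by rewrite pX_neq0 cQ.
have nc : nrm c%:R = 1.
  by rewrite pmulrn pnorm_int // ?eqz_nat -?lt0n // lognE (negbTE cp) !andbF expr0 invr1.
rewrite !pnormM // !pnormV // pnorm_pexpn // nc invr1 mul1r invrK.
rewrite -[leRHS]mul1r ler_pM ?pnorm_ge0 ?mulr_ge0 ?exprn_ge0 ?pnorm_int_le1 ?pnorm_ge0 ?(ltW pQ_gt0) //.
by rewrite ler_wpM2l // exprn_ge0 // ltW.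
Qed.

(** The density argument: if [x] is a root, the polynomial at the rational point [approx p x n] has
    norm at most [W / p ^ n], which is below [e] for large [n]. The first summand of [W] bounds the
    value of [eval_state], the others the errors in the coefficients. *)
Lemma no_root_of_pnorm_ge (d : nat) (D : Qp_raw -> Prop) (s : state d) (e : rat) :
  0 < e -> (forall x, e <= nrm (\sum_(i < d.+1) odflt 0 (s i) * x ^+ i)) ->
  ~ has_root_in p D s.
Proof.
move=> e0 ge_e [x [_ root]].
pose q i := odflt 0 (s i); pose v i := (Qp_of_rat p (q i)).1.
pose W := p%:R ^+ (eval_state p s x).1
  + \sum_(i < d.+1) p%:R ^+ v i * p%:R ^+ (x.1 * i) : rat.
have p0 k : 0 <= p%:R ^+ k :> rat by rewrite exprn_ge0 // ltW.
have [n] := exists_pexpz_gt p_pr (W / e).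
rewrite ltNge ler_pdivlMr // => /negP; apply.
have pn0 : 0 < p%:R ^+ n :> rat by rewrite exprn_gt0.
rewrite -ler_pdivlMl // mulrC; apply: le_trans (ge_e (approx p x n)) _.
have -> : \sum_(i < d.+1) odflt 0 (s i) * approx p x n ^+ i =
    approx p (eval_state p s x) n - \sum_(i < d.+1)
      (approx p (Qp_of_rat p (q i)) n - q i) * approx p x n ^+ i.
  rewrite approx_eval_state -sumrB; apply: eq_bigr => i _.
  by rewrite mulrBl subKr.
apply: le_trans (pnormD _ _ _) _ => //; rewrite pnormN ge_max.
have x1 : nrm (approx p x n) <= p%:R ^+ x.1.
  rewrite /approx pnormM // pnormV // pnorm_pexpn // invrK.
  by rewrite ler_piMl ?pnorm_int_le1.
apply/andP; split.
  have := root n; rewrite /= /ppow expr0 mul1r mulr0 subr0 -/(ppow p n).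
  rewrite -pnorm_int_le // => Y; rewrite /approx pnormM // pnormV // pnorm_pexpn // invrK.
  apply: le_trans (_ : p%:R ^- n * p%:R ^+ (eval_state p s x).1 <= _).
    by rewrite ler_wpM2r.
  rewrite mulrC ler_pM2r ?invr_gt0 // lerDl sumr_ge0 // => i _.
  by rewrite mulr_ge0.
apply: pnorm_sum_le => // [|i _].
  by rewrite mulr_ge0 ?invr_ge0 // addr_ge0 // sumr_ge0 // => i _; rewrite mulr_ge0.
rewrite pnormM // pnormX //.
apply: le_trans (_ : p%:R ^+ v i / p%:R ^+ n * p%:R ^+ (x.1 * i) <= _).
  rewrite ler_pM ?exprn_ge0 ?pnorm_ge0 ?approx_of_rat // exprM.
  by rewrite lerXn2r ?nnegrE ?pnorm_ge0.
rewrite mulrAC ler_pM2r ?invr_gt0 // /W (bigD1 i) //= addrCA lerDl.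
by rewrite addr_ge0 // sumr_ge0 // => j _; rewrite mulr_ge0.
Qed.

Definition Qp_nat (m : nat) : Qp_raw := (0%N, fun _ => m%:Z).

Lemma Qp_pow_nat_exp m i : (Qp_pow (Qp_nat m) i).1 = 0%N.
Proof. by elim: i => //= i ->. Qed.

(** [Qp_add] adds the exponents of the denominators, so the total bounds that of each
    coefficient. *)
Lemma exp_of_rat_le_eval_state (d : nat) (s : state d) m (i : 'I_d.+1) :
  ((Qp_of_rat p (odflt 0%R (s i))).1 <= (eval_state p s (Qp_nat m)).1)%N.
Proof.
rewrite /eval_state; have := mem_enum 'I_d.+1 i.
elim: (enum _) => //= j r IH; rewrite inE => /predU1P[<-|/IH le].
  by rewrite Qp_pow_nat_exp addn0 leq_addr.
exact: leq_trans le (leq_addl _ _).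
Qed.

(** Only the coefficients are approximated, as [m] is represented exactly. Their errors, of norm at
    most [p ^ v / p ^ n], are absorbed by the common denominator of [eval_state], whose exponent is
    at least each [v]. *)
Lemma nat_root (d : nat) (s : state d) m :
  \sum_(i < d.+1) odflt 0 (s i) * m%:R ^+ i = 0 ->
  Qp_eq p (eval_state p s (Qp_nat m)) Qp_zero.
Proof.
move=> root n; set Y := eval_state _ _ _.
rewrite /= /ppow expr0 mul1r mulr0 subr0 -/(ppow p n) -pnorm_int_le //.
have YE : (Y.2 n)%:~R = approx p Y n * p%:R ^+ Y.1 by rewrite /approx divfK.
have p0 k : 0 <= p%:R ^+ k :> rat by rewrite exprn_ge0 // ltW.
have pn0 k : 0 < p%:R ^+ k :> rat by rewrite exprn_gt0.
rewrite YE pnormM // pnorm_pexpn // ler_pdivrMr // mulrC.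
rewrite -[approx _ _ _]subr0 -root approx_eval_state -sumrB.
apply: pnorm_sum_le => // [|i _]; first by rewrite mulr_ge0 ?invr_ge0.
have -> : approx p (Qp_nat m) n = m%:R by rewrite /approx divr1.
rewrite -mulrBl pnormM // pnormX //.
apply: le_trans (_ : nrm (approx p (Qp_of_rat p (odflt 0 (s i))) n - odflt 0 (s i)) <= _).
  rewrite ler_piMr ?pnorm_ge0 // exprn_ile1 ?pnorm_ge0 //.
  by rewrite pmulrn pnorm_int_le1.
apply: le_trans (approx_of_rat _ _) _; rewrite ler_pM2r ?invr_gt0 //.
by rewrite ler_weXn2l ?exp_of_rat_le_eval_state // ler1n prime_gt0.
Qed.

(** This is why an arbitrary unital subring will do: Wanda's roots are natural numbers. Zero is
    obtained as [1 - 1]. *)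
Lemma Qp_subring_nat (D : Qp_raw -> Prop) m : Qp_subring p D -> D (Qp_nat m).
Proof.
have valid k : Qp_valid p (Qp_nat k) by move=> n; rewrite /= subrr dvdz0.
case=> [_ [sat [D1 [DD [DN _]]]]]; elim: m => [|m IH].
  apply: (sat _ _ (valid _) _ (DD _ _ D1 (DN _ D1))) => n.
  by rewrite /= /ppow expr0 !mul1r subrr.
apply: (sat _ _ (valid _) _ (DD _ _ IH D1)) => n.
by rewrite /= /ppow expr0 !mul1r -addn1 PoszD subrr.
Qed.

Lemma has_root_in_nat (d : nat) (D : Qp_raw -> Prop) (s : state d) m :
  Qp_subring p D -> \sum_(i < d.+1) odflt 0 (s i) * m%:R ^+ i = 0 ->
  has_root_in p D s.
Proof.
by move=> DR root; exists (Qp_nat m); split; [exact: Qp_subring_nat | exact: nat_root].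
Qed.

End Approximants.

(** * Wanda's last coefficient *)

(** There are fewer roots than [size P]. Positivity of [m] permits the division by [m ^ l] in
    [rooting_coefficient]. *)
Lemma exists_nat_nonroot (P : {poly rat}) : P != 0 -> exists2 m : nat, (0 < m)%N & P.[m%:R] != 0.
Proof.
move=> P0; pose r := [seq i.+1%:R : rat | i <- iota 0 (size P)].
have [/hasP[_ /mapP[i _ ->] nr]|no] := boolP (has (fun x => ~~ root P x) r); first by exists i.+1.
have A : all (root P) r.
  by move: no; rewrite -all_predC; apply: sub_all => x /=; rewrite negbK.
have U : uniq r.
  by rewrite map_inj_uniq ?iota_uniq // => i j /eqP; rewrite eqr_nat => /eqP[].
by have := max_poly_roots P0 A U; rewrite size_map size_iota ltnn.
Qed.

Lemma rooting_coefficient (d l : nat) (a : nat -> rat) :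
  (0 < d)%N -> (l <= d)%N -> (l != 0 -> a 0 != 0) -> (l != d -> a d != 0) ->
  exists c : rat, ((l == 0) || (l == d) -> c != 0) /\
    exists m : nat, \sum_(i < d.+1) set_coef a l c i * m%:R ^+ i = 0.
Proof.
move=> d0 ld a0 ad; pose P := \poly_(i < d.+1) set_coef a l 0 i.
have PE x c : \sum_(i < d.+1) set_coef a l c i * x ^+ i = P.[x] + c * x ^+ l.
  have ldS : (l < d.+1)%N by [].
  rewrite horner_poly (bigD1 (Ordinal ldS)) //= [in RHS](bigD1 (Ordinal ldS)) //=.
  rewrite /set_coef eqxx mul0r add0r addrC.
  congr (_ + _); apply: eq_bigr => i; rewrite -val_eqE /= => /negbTE il.
  by rewrite il.
have [m m0 Pm] : exists2 m : nat, (0 < m)%N & ((l == 0) || (l == d) -> P.[m%:R] != 0).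
  have [ends|_] := boolP ((l == 0) || (l == d)); last by exists 1%N.
  have [|m m0 Pm] := @exists_nat_nonroot P; last by exists m.
  (* When [l] is one end, the coefficient at the other end is nonzero, so [P] is not the zero
     polynomial. *)
  apply/eqP => P0; have coefP0 j : (j <= d)%N -> set_coef a l 0 j = 0.
    by move=> jd; have := congr1 (fun Q : {poly rat} => Q`_j) P0; rewrite coef_poly ltnS jd coef0.
  case/orP: ends => /eqP E.
    have := coefP0 d (leqnn d); rewrite /set_coef E gtn_eqF // => /eqP.
    by apply/negP/ad; rewrite E ltn_eqF.
  have := coefP0 0%N (leq0n d); rewrite /set_coef E ltn_eqF // => /eqP.
  by apply/negP/a0; rewrite E gtn_eqF.
have mX : m%:R ^+ l != 0 :> rat by rewrite expf_neq0 // pnatr_eq0 -lt0n.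
exists (- P.[m%:R] / m%:R ^+ l); split; last by exists m; rewrite PE divfK // subrr.
by move/Pm => Pm0; rewrite mulf_neq0 ?oppr_eq0 ?invr_eq0.
Qed.

(** * Strategies *)

Section Game.

Variables (d p : nat) (D : Qp_raw -> Prop).

Definition open (s : state d) : {set 'I_d.+1} := [set i | s i == None].

(** An invariant of legal play; an end that is still open satisfies it. *)
Definition ends_ok (s : state d) : bool := (s ord0 != Some 0) && (s ord_max != Some 0).

(** If [P] makes the last of [k] remaining moves, the parity of [k] tells who moves now. *)
Definition last_mover_wins (P : player) (k : nat) (s : state d) : Prop :=
  can_force p D P k (if odd k then P else other P) s.

Lemma assign_eq (s : state d) i c : assign s i c i = Some c.
Proof. by rewrite ffunE eqxx. Qed.

Lemma assign_neq (s : state d) i j c : j != i -> assign s i c j = s j.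
Proof. by rewrite ffunE => /negbTE ->. Qed.

Lemma assign_keep (s : state d) i j c : s i = None -> s j != None -> assign s i c j = s j.
Proof. by move=> si sj; rewrite assign_neq //; apply: contra sj => /eqP ->; rewrite si. Qed.

Lemma card_open_assign (s : state d) i c k : s i = None ->
  #|open s| = k.+1 -> #|open (assign s i c)| = k.
Proof.
move=> si; rewrite (cardsD1 i) inE si eqxx => -[<-]; apply: eq_card => j.
by rewrite !inE ffunE; case: (j == i).
Qed.

Lemma ends_ok_assign (s : state d) i c : legal s i c -> ends_ok s -> ends_ok (assign s i c).
Proof.
move=> [_ c0] /andP[s0 sd]; apply/andP; rewrite !ffunE; split.
  by case: (ord0 =P i) => // E; rewrite (inj_eq Some_inj) c0 // -E.
by case: (ord_max =P i) => // E; rewrite (inj_eq Some_inj) c0 // -E /= eqxx orbT.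
Qed.

Lemma ends_ok_neq0 (s : state d) (j : 'I_d.+1) : ends_ok s -> s j != None ->
  (val j == 0) || (val j == d) -> odflt 0 (s j) != 0.
Proof.
case/andP=> s0 sd; case E: (s j) => [c|] // _ /orP[] /eqP je /=.
  by apply: contra s0 => /eqP <-; rewrite -E; apply/eqP; congr (s _); apply: val_inj.
by apply: contra sd => /eqP <-; rewrite -E; apply/eqP; congr (s _); apply: val_inj.
Qed.

Lemma last_mover_wins_own_move (P : player) k (s : state d) i c : ~~ odd k -> legal s i c ->
  last_mover_wins P k (assign s i c) -> last_mover_wins P k.+1 s.
Proof. by rewrite /last_mover_wins /= => /negbTE -> lg W; case: P W => W; exists i, c. Qed.

Lemma last_mover_wins_other_move (P : player) k (s : state d) : odd k ->
  (forall i c, legal s i c -> last_mover_wins P k (assign s i c)) -> last_mover_wins P k.+1 s.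
Proof. by rewrite /last_mover_wins /= => -> W; case: P W. Qed.

(** Since every move preserves [good], earlier moves may be arbitrary and only the last one needs
    thought. *)
Lemma last_mover_wins_of_last_move (P : player) (good : state d -> bool) :
  (forall (s : state d) i c, s i = None -> good s -> good (assign s i c)) ->
  (forall (s : state d) l, ends_ok s -> good s -> s l = None -> (forall i, i != l -> s i != None) ->
     exists c, legal s l c /\ wins p D P (assign s l c)) ->
  forall k s, #|open s| = k.+1 -> ends_ok s -> good s -> last_mover_wins P k.+1 s.
Proof.
move=> keep last; elim=> [|k IH] s sk es gs.
  have /cards1P[l sl] : #|open s| == 1 by rewrite sk.
  have slN i : (s i == None) = (i == l) by have := in_set1 i l; rewrite -sl inE.
  have [||||c [lg W]] := last s l => //; first by apply/eqP; rewrite slN.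
    by move=> i; rewrite slN.
  exact: (@last_mover_wins_own_move P 0 s l c isT lg W).
have next i c : legal s i c -> last_mover_wins P k.+1 (assign s i c).
  move=> lg; apply: IH; [apply: card_open_assign sk; exact: lg.1 | exact: ends_ok_assign |].
  by apply: keep => //; exact: lg.1.
have [ok|ek] := boolP (odd k.+1); first exact: last_mover_wins_other_move.
have /card_gt0P[i] : (0 < #|open s|)%N by rewrite sk.
(* The value 1 is nonzero, hence legal at the ends too. *)
rewrite inE => /eqP si; have lg : legal s i 1 by split.
exact: last_mover_wins_own_move ek lg (next _ _ lg).
Qed.

Lemma legal_mid (s : state d) (i : 'I_d.+1) c :
  s i = None -> (0 < i < d)%N -> legal s i c.
Proof. by move=> si /andP[i0 id]; split=> //; rewrite gtn_eqF //= ltn_eqF. Qed.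

Definition coef (s : state d) (j : nat) : rat := odflt 0 (s (inord j)).

Lemma sum_assign (s : state d) (l : 'I_d.+1) c x :
  \sum_(i < d.+1) odflt 0 (assign s l c i) * x ^+ i =
  \sum_(i < d.+1) set_coef (coef s) l c i * x ^+ i.
Proof.
apply: eq_bigr => i _; rewrite ffunE /set_coef /coef inord_val val_eqE.
by case: eqP.
Qed.

Lemma coef_end_neq0 (s : state d) (l : 'I_d.+1) (j : nat) : ends_ok s ->
  (forall i, i != l -> s i != None) -> (j == 0%N) || (j == d) -> l != j :> nat ->
  coef s j != 0.
Proof.
move=> es full je lj; have jd : (j < d.+1)%N by case/orP: je => /eqP ->.
apply: ends_ok_neq0 => //; last by rewrite /= inordK.
by apply: full; rewrite -val_eqE /= inordK // eq_sym.
Qed.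

Hypotheses (d_gt1 : (1 < d)%N) (p_pr : prime p) (D_subring : Qp_subring p D).

Lemma wanda_wins (k : nat) (s : state d) :
  #|open s| = k.+1 -> ends_ok s -> last_mover_wins Wanda k.+1 s.
Proof.
move=> sk es; apply: (@last_mover_wins_of_last_move Wanda xpredT) => // {k sk es} s l es _ sl full.
have [|||| c [c0 [m root]]] := @rooting_coefficient d l (coef s).
- exact: ltnW.
- by rewrite -ltnS.
- exact: coef_end_neq0.
- by apply: coef_end_neq0; rewrite ?eqxx ?orbT.
exists c; split=> //; apply: (@has_root_in_nat p p_pr d D _ m) => //.
by rewrite sum_assign.
Qed.

(** Positions coincide for small degrees: [id1] is [i1] for [d = 2] and [i2] for [d = 3]. *)
Let i1 : 'I_d.+1 := inord 1.
Let i2 : 'I_d.+1 := inord 2.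
Let id1 : 'I_d.+1 := inord d.-1.

Let i1E : i1 = 1 :> nat. Proof. by rewrite inordK // ltnS ltnW. Qed.
Let i2E : i2 = 2 :> nat. Proof. by rewrite inordK. Qed.
Let id1E : id1 = d.-1 :> nat. Proof. by rewrite inordK // ltnS leq_pred. Qed.

(* If Nora moves last from such a position, her last coefficient is an end coefficient, or one with
   2 <= l <= d - 2 and d >= 5, or the middle one of a trinomial. *)
Definition safe (s : state d) : bool :=
  [&& s i1 != None, (d == 3) || (s id1 != None) &
   [|| (4 < d)%N, s i2 != None | (s i1 == Some 0) && ((d == 3) || (s id1 == Some 0))]].

Lemma safe_assign (s : state d) i c : s i = None -> safe s -> safe (assign s i c).
Proof.
move=> si /and3P[s1 sd1 s2]; have keep j : s j != None -> assign s i c j = s j.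
  exact: assign_keep.
apply/and3P; split; first by rewrite keep.
  by case/orP: sd1 => [->//|sd1]; rewrite keep // sd1 orbT.
case/or3P: s2 => [->//|s2|/andP[/eqP s10 sd]].
  by rewrite (keep i2) // s2 orbT.
rewrite (keep i1) ?s10 // eqxx; case/orP: sd => [->|/eqP sd]; first by rewrite !orbT.
by rewrite (keep id1) sd // eqxx !orbT.
Qed.

Lemma nora_last_move (s : state d) (l : 'I_d.+1) : ends_ok s -> safe s -> s l = None ->
  (forall i, i != l -> s i != None) ->
  exists c, legal s l c /\ wins p D Nora (assign s l c).
Proof.
move=> es /and3P[s1 sd1 s2] sl full.
have ld : (l <= d)%N by rewrite -ltnS.
have a0 : l != 0 :> nat -> coef s 0 != 0 by apply: coef_end_neq0.
have ad : l != d :> nat -> coef s d != 0 by apply: coef_end_neq0; rewrite // eqxx orbT.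
have nl j : s j != None -> l != j :> nat.
  by move=> sj; apply: contra sj => /eqP/val_inj <-; rewrite sl.
have nowin c e : 0 < e ->
    (forall x, e <= pnorm p (\sum_(i < d.+1) set_coef (coef s) l c i * x ^+ i)) ->
    wins p D Nora (assign s l c).
  move=> e0 ge; apply: (no_root_of_pnorm_ge p_pr e0) => x.
  by rewrite sum_assign.
have l1 : l != 1 :> nat by rewrite -i1E nl.
(* The positions excluded by [huge_coefficient] that a safe state may leave for the end: [l = d - 1]
   for [d = 3], and the middle for [d = 4]. *)
have [mid|nmid] := boolP ((l == 2 :> nat) && ((d == 3) || (d == 4))).
  have [/eqP l2 d34] := andP mid.
  have d4 : (4 < d)%N = false by case/orP: d34 => /eqP ->.
  have sl2 : s i2 = None by rewrite -sl; congr (s _); apply: val_inj; rewrite /= i2E.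
  move: s2; rewrite d4 sl2 eqxx /= => /andP[/eqP s10 sd0].
  have d2 : (2 < d)%N by case/orP: d34 => /eqP ->.
  have [||||c ge] := @trinomial_coefficient p p_pr d l (coef s).
  - by rewrite l2.
  - by apply: a0; rewrite l2.
  - by apply: ad; rewrite l2 neq_ltn d2.
  - rewrite l2 => j /andP[j0 jd] j2; rewrite /coef; have [->|j1] := eqVneq j 1.
      by rewrite -/i1 s10.
    have [d3 j3] : d == 4 /\ j = d.-1.
      by move: d34 j0 jd j2 j1; clear; case/orP => /eqP ->; case: j => [|[|[|[|j]]]].
    by rewrite j3 -/id1; case/orP: sd0 => /eqP E; [rewrite E in d3 | rewrite E].
  exists c; split; first by apply: legal_mid; rewrite // l2.
  apply: nowin ge; rewrite pnorm_gt0 // /set_coef l2 /=; apply: a0; by rewrite l2.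
have ld1 : l.+1 != d.
  case/orP: sd1 => [/eqP d3|sd1].
    apply: contra nmid => /eqP E; have -> : l = 2 :> nat by apply: succn_inj; rewrite E d3.
    by rewrite d3.
  by have := nl _ sd1; rewrite id1E; apply: contra => /eqP/(congr1 predn) /= ->.
have [|||c c0 ge] := @huge_coefficient p p_pr d l (coef s) d_gt1 ld l1 ld1 => //.
  by apply: contra nmid => /andP[-> ->]; rewrite orbT.
exists c; split=> //; apply: nowin ge; rewrite pnorm_gt0 // /set_coef.
by case: (eqVneq 0%N l) => // l0; apply: a0; rewrite eq_sym.
Qed.

Lemma safe_wins k (s : state d) :
  #|open s| = k.+1 -> ends_ok s -> safe s -> last_mover_wins Nora k.+1 s.
Proof. exact: last_mover_wins_of_last_move safe_assign nora_last_move k s. Qed.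

Lemma safe_next_wins k (s : state d) i c : ~~ odd k.+1 -> legal s i c ->
  #|open s| = k.+2 -> ends_ok s -> safe (assign s i c) -> last_mover_wins Nora k.+2 s.
Proof.
move=> ek lg sk es sf; apply: (last_mover_wins_own_move ek lg); apply: safe_wins => //.
  by apply: card_open_assign sk; exact: lg.1.
exact: ends_ok_assign.
Qed.

Let mid1 : (0 < i1 < d)%N. Proof. by rewrite i1E. Qed.
Let midd1 : (0 < id1 < d)%N. Proof. by rewrite id1E -ltnS prednK ?(ltnW d_gt1) // d_gt1 leqnn. Qed.

(** It is Nora's turn, and one move reaches a safe state: 0 at [d - 1] if that is open. Otherwise
    the state can only be unsafe for [d = 4] with position 2 open, and she fills it. *)
Lemma first_filled_wins k (s : state d) : (3 < d)%N -> ~~ odd k.+1 ->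
  #|open s| = k.+2 -> ends_ok s -> s i1 != None -> (d == 4) ==> (s i1 == Some 0) ->
  last_mover_wins Nora k.+2 s.
Proof.
move=> d3 ek sk es s1 s10.
have d3F : (d == 3) = false by rewrite gtn_eqF.
have [/eqP sd1|sd1] := boolP (s id1 == None).
  apply: (@safe_next_wins _ _ id1 0) => //; first exact: legal_mid.
  rewrite /safe assign_eq (assign_keep _ _ s1) // s1 d3F eqxx andbT /=.
  by have [//|d4] := ltnP 4 d; move: s10; rewrite eqn_leq d4 d3 /= => ->; rewrite orbT.
have [d4|d4] := ltnP 4 d; first by apply: safe_wins => //; rewrite /safe s1 sd1 d4 orbT.
have [/eqP s2|s2] := boolP (s i2 == None); last first.
  by apply: safe_wins => //; rewrite /safe s1 sd1 s2 !orbT.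
apply: (@safe_next_wins _ _ i2 0) => //; first by apply: legal_mid => //; rewrite i2E; exact: ltnW.
by rewrite /safe assign_eq !(assign_keep _ s2) // s1 sd1 !orbT.
Qed.

(** Nora fills position 1 unless that is done already; after the reply she is in the situation of
    [first_filled_wins]. For [d = 4] she must put the 0 there herself, so as to be left with a
    trinomial if position 2 comes last. *)
Lemma nora_turn_wins k (s : state d) : (3 < d)%N -> ~~ odd k.+1 ->
  #|open s| = k.+4 -> ends_ok s -> (d == 4) ==> (s i1 == None) ->
  last_mover_wins Nora k.+4 s.
Proof.
move=> d3 ek sk es s10; have [/eqP s1|s1] := boolP (s i1 == None); last first.
  apply: first_filled_wins => //; first by rewrite /= negbK.
  by move: s10; rewrite (negbTE s1); case: eqP.
have lg : legal s i1 0 by apply: legal_mid.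
apply: (last_mover_wins_own_move _ lg); first by rewrite /= negbK.
apply: last_mover_wins_other_move => [|i c lg2]; first by move: ek; rewrite /= !negbK.
have F : assign (assign s i1 0) i c i1 = Some 0.
  by rewrite assign_keep ?assign_eq //; exact: lg2.1.
apply: first_filled_wins; rewrite ?F ?eqxx ?implybT //.
  by apply: card_open_assign lg2.1 _; apply: card_open_assign sk.
by apply: ends_ok_assign => //; exact: ends_ok_assign.
Qed.

Lemma card_open_empty : #|open (empty_state d)| = d.+1.
Proof. by rewrite -[RHS]card_ord; apply: eq_card => i; rewrite !inE ffunE. Qed.

Lemma ends_ok_empty : ends_ok (empty_state d).
Proof. by rewrite /ends_ok !ffunE. Qed.

Lemma nora_wins : last_mover_wins Nora d.+1 (empty_state d).
Proof.
have es := ends_ok_empty.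
have sN i : empty_state d i = None by rewrite ffunE.
(* Naming the number of moves [n] lets it be rewritten without touching the type [state d]. *)
suff W n : n = d.+1 -> last_mover_wins Nora n (empty_state d) by exact: W.
move=> nE; have sk : #|open (empty_state d)| = n by rewrite nE card_open_empty.
have [d3|d3] := ltnP 3 d.
  have [on|en] := boolP (odd n).
    have [k kE] : exists k, n = k.+4.
      by exists (n - 4)%N; move: nE d3; clear; lia.
    rewrite kE in sk on *; apply: nora_turn_wins => //.
      by move: on; rewrite /= !negbK.
    by rewrite sN eqxx implybT.
  have [k kE] : exists k, n = k.+4.+1.
    by exists (n - 5)%N; move: nE d3 en; clear; case: n => // n [->]; lia.
  rewrite kE in sk en nE *; apply: last_mover_wins_other_move => [|i c lg].
    by move: en; rewrite /= !negbK.
  apply: nora_turn_wins => //.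
  - by move: en; rewrite /= !negbK.
  - exact: card_open_assign lg.1 sk.
  - exact: ends_ok_assign.
  (* For [d = 4] there are five moves, so Wanda does not begin. *)
  by apply/implyP => /eqP d4; exfalso; move: en; rewrite nE d4.
have lg1 (s : state d) : s i1 = None -> legal s i1 0 by move=> s1; exact: legal_mid.
have [d2|d2] : d = 2 \/ d = 3 by move: d_gt1 d3; clear; lia.
  rewrite d2 in nE; rewrite nE in sk *; apply: (safe_next_wins _ (lg1 _ (sN _))) => //.
  by rewrite /safe (_ : id1 = i1) ?assign_eq ?orbT //; apply: val_inj; rewrite /= id1E i1E d2.
(* For [d = 3] Wanda begins. If she leaves position 1 open, Nora puts 0 there; otherwise Nora fills
   position 2, and an end comes last. *)
rewrite d2 in nE; rewrite nE in sk *; apply: last_mover_wins_other_move => // i c lg.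
have sk' := card_open_assign c lg.1 sk; have es' := ends_ok_assign lg es.
have [/eqP s1|s1] := boolP (assign (empty_state d) i c i1 == None).
  apply: (safe_next_wins _ (lg1 _ s1)) => //.
  by rewrite /safe assign_eq (introT eqP d2) !orbT.
have ii : i1 == i by apply: contraNT s1 => ne; rewrite assign_neq // sN.
have s2 : assign (empty_state d) i c i2 = None.
  by rewrite assign_neq ?sN // -(eqP ii) -val_eqE /= i1E i2E.
have lg2 : legal (assign (empty_state d) i c) i2 0 by apply: legal_mid => //; rewrite i2E d2.
apply: (safe_next_wins _ lg2) => //.
by rewrite /safe assign_eq (assign_keep _ s2) // s1 (introT eqP d2) !orbT.
Qed.

End Game.

(* For either choice of first player, the player making the last (the
   (d+1)-th) move has a winning strategy. *)
Theorem theorem2 (d p : nat) (D : Qp_raw -> Prop) (first : player) :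
  (1 < d)%N -> prime p -> Qp_subring p D ->
  let last := if odd d.+1 then first else other first in
  can_force p D last d.+1 first (empty_state d).
Proof.
move=> d1 p_pr DR last.
have otherK P : other (other P) = P by case: P.
(* Solving for [first] brings the goal into the form of [last_mover_wins]. *)
have fE : first = if odd d.+1 then last else other last.
  by rewrite /last; case: (odd _); rewrite ?otherK.
clearbody last; rewrite {}fE; case: last.
  exact: nora_wins.
exact: (wanda_wins d1 p_pr DR (card_open_empty d) (ends_ok_empty d)).
Qed.
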